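(* Let $n$ be a positive integer. In every $4$-coloring of the edges of $K_n$ there is a monochromatic connected component with at least $\frac{1}{12}\binom{n}{2}$ edges; that is, $M(n,4)\geq \left\lceil \frac{1}{12}\binom{n}{2}\right\rceil$. Moreover, unless the coloring matches Gyárfás's construction, there is a monochromatic connected component with at least $\left(\frac{1}{12}+\varepsilon\right)\binom{n}{2}$ edges, where $\varepsilon=\frac{2}{14+\sqrt{96}}-\frac{1}{12}>0.0007$.
   Context: For an edge-coloring of $K_n$ with colors $1,\dots,r$, let $G_i$ be the spanning subgraph of $K_n$ on all $n$ vertices whose edges are those of color $i$. A monochromatic (connected) component of color $i$ is a connected component of $G_i$ (a vertex isolated in color $i$ forms a component with no edges). $M(n,r)$ denotes the largest integer such that every $r$-coloring of the edges of $K_n$ has a monochromatic component with at least $M(n,r)$ edges. A $4$-coloring ''matches Gyárfás's construction'' if the set of monochromatic components and the intersection pattern of their vertex sets are as in the following configuration: each color has exactly three components, and the vertex set is partitioned into nine nonempty sets $V_p$ indexed by the points $p$ of the affine plane $\mathbb{F}_3^2$, such that the four colors correspond bijectively to the four parallel classes of lines of $\mathbb{F}_3^2$ and the vertex sets of the components of a given color are exactly the sets $\bigcup_{p\in L}V_p$ for the three lines $L$ of the corresponding parallel class. *)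

(* Defs.v *)
From mathcomp Require Import all_boot all_order all_algebra.

Set Implicit Arguments.
Unset Strict Implicit.
Unset Printing Implicit Defensive.

Definition edge (n : nat) : finType := {e : {set 'I_n} | #|e| == 2}.

Definition edge_coloring (n r : nat) : finType := {ffun edge n -> 'I_r}.

Definition color_adj (n r : nat) (c : edge_coloring n r) (i : 'I_r) :
    rel 'I_n :=
  fun x y => [exists e : edge n, (val e == [set x; y]) && (c e == i)].

(* Vertex sets of the connected components of the spanning subgraph G_i;
   vertices isolated in color i give singletons. *)
Definition components (n r : nat) (c : edge_coloring n r) (i : 'I_r) :
    {set {set 'I_n}} :=
  equivalence_partition (connect (color_adj c i)) [set: 'I_n].

Definition component_edges (n r : nat) (c : edge_coloring n r) (i : 'I_r)
    (A : {set 'I_n}) : {set edge n} :=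
  [set e : edge n | (c e == i) && (val e \subset A)].

Definition has_large_component (n r : nat) (c : edge_coloring n r) (m : nat) :=
  [exists i : 'I_r, exists A in components c i, m <= #|component_edges c i A|].

(* The bound 'C(n, 2) on the candidates loses nothing when 0 < r, since a
   coloring then exists and has only 'C(n, 2) edges: see leq_M. *)
Definition M (n r : nat) : nat :=
  \max_(m < 'C(n, 2).+1 |
          [forall c : edge_coloring n r, has_large_component c m]) m.

Lemma card_edge (n : nat) : #|{: edge n}| = 'C(n, 2).
Proof.
rewrite card_sig -[n in 'C(n, _)]card_ord -card_draws.
by rewrite cardsE; apply: eq_card => A; rewrite !inE.
Qed.

Lemma leq_M (n r m : nat) : 0 < n -> 0 < r ->
  (m <= M n r) = [forall c : edge_coloring n r, has_large_component c m].
Proof.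
move=> n_gt0 r_gt0; apply/idP/idP.
  pose P (k : 'I_('C(n, 2).+1)) :=
    [forall c : edge_coloring n r, has_large_component c k].
  have P0 : P ord0.
    apply/forallP => c; apply/existsP; exists (Ordinal r_gt0).
    apply/existsP; exists [set y in [set: 'I_n] |
      connect (color_adj c (Ordinal r_gt0)) (Ordinal n_gt0) y].
    by rewrite leq0n andbT; apply: imset_f; rewrite inE.
  rewrite /M; case: (eq_bigmax_cond (fun k : 'I_('C(n, 2).+1) => k : nat) (A := P)).
    by apply/card_gt0P; exists ord0.
  move=> k Pk ->  le_mk.
  apply/forallP => c; have /existsP[i /existsP[A /andP[Ai le_k]]] := forallP Pk c.
  by apply/existsP; exists i; apply/existsP; exists A; rewrite Ai (leq_trans le_mk).
move=> Pm; have /existsP[i /existsP[A /andP[_ le_m]]] :=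
  forallP Pm [ffun=> Ordinal r_gt0].
have lt_m : m < 'C(n, 2).+1 by rewrite ltnS (leq_trans le_m) // -card_edge max_card.
exact: (leq_bigmax_cond (Ordinal lt_m)).
Qed.

Definition point : finType := 'rV['F_3]_2.

Definition line (a v : point) : {set point} :=
  [set (a + t *: v)%R | t : 'F_3].

Definition parallel_class (v : point) : {set {set point}} :=
  [set line a v | a : point].

Definition parallel_classes : {set {set {set point}}} :=
  [set parallel_class v | v : point & v != 0%R].

Definition matches_gyarfas (n : nat) (c : edge_coloring n 4) : Prop :=
  (forall i : 'I_4, #|components c i| = 3) /\
  exists (V : point -> {set 'I_n}) (pc : 'I_4 -> {set {set point}}),
    [/\ forall p, V p != set0,
        forall p q, p != q -> [disjoint V p & V q],
        \bigcup_p V p = [set: 'I_n],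
        injective pc /\ [set pc i | i : 'I_4] = parallel_classes
      & forall i, components c i = [set \bigcup_(p in L) V p | L : {set point} in pc i]].

(* Main.v *)
(** Put N = 1 + sqrt 6, so that N^2 = 5 + 2 N and 1/12 + eps = 1/N^2. Suppose
    every component has fewer than 'C(n, 2)/N^2 edges, and measure a component X
    by mu(X) = N |X| / n and by its number of edges phi(X) in units of
    'C(n, 2)/N^2; then phi(X) < 1 and phi(X) <= mu(X)^2, and the phi(X) add up
    to N^2. Choosing K components, and bounding phi by 1 on
    these and by mu on the others, gives N^2 < K + r N as soon as every vertex
    lies in chosen components of all but r colours. This excludes K = 5, r = 2 and
    K = 8, r = 1. Two components never cover the vertex set, because the cap
    min(1, mu^2) loses at least (N - 3)/2 on every family of disjoint components.

    The only other information is that any two vertices lie in a common component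
    of some colour. If three components of different colours cover the vertex set,
    then looking at the parts covered only once always exhibits an excluded choice.
    Hence no component lies inside a component of another colour. It follows that
    two disjoint components A, B of different colours are both cut in two by the
    remaining colours, crosswise, which leads to a choice with K = 8, r = 1. So
    components of different colours always meet. Then two vertices that agree in
    two colours agree in all four, every colour has three components, and the cells
    form the affine plane over F_3. *)

Require Import Defs.
From mathcomp Require Import all_boot all_order all_algebra.
From mathcomp Require Import boolp reals.
From mathcomp Require Import lra ring zify.

Set Implicit Arguments.
Unset Strict Implicit.
Unset Printing Implicit Defensive.

Import Order.TTheory GRing.Theory Num.Theory.

(** * Complete bipartite graphs covered by two equivalence relations *)

(** The outcomes when each vertex of [X] shares an [e]- or a [g]-label with each vertex of [Y]. In
    [BipSquare] the sets lie crosswise on a 2 by 2 grid of cells: [X] on the diagonal, [Y] on the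
    antidiagonal. *)
Variant bipartite_spec (T L : Type) (e g : T -> L) (X Y : T -> Prop) : Prop :=
| BipLeft a of forall v, X v \/ Y v -> e v = a
| BipRight a of forall v, X v \/ Y v -> g v = a
| BipCellX a b of forall x, X x -> e x = a /\ g x = b
| BipCellY a b of forall y, Y y -> e y = a /\ g y = b
| BipSquare x1 x2 y1 y2 of [/\ X x1, X x2, Y y1 & Y y2]
    & e x1 <> e x2 & g x1 <> g x2
    & forall x, X x -> e x = e x1 /\ g x = g x1 \/ e x = e x2 /\ g x = g x2
    & (e y1 = e x1 /\ g y1 = g x2) /\ (e y2 = e x2 /\ g y2 = g x1)
    & forall y, Y y -> e y = e x1 /\ g y = g x2 \/ e y = e x2 /\ g y = g x1.

Lemma forall_or_counterexample (T : Type) (P : T -> Prop) :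
  (forall v, P v) \/ exists v, ~ P v.
Proof. by have [h|/existsNP h] := EM (forall v, P v); [left|right]. Qed.

(** Vertices of [X] that differ in both labels leave two cells to [Y], crosswise to theirs. If [Y]
    meets both, it confines [X] in the same way; otherwise it fits into one cell. *)
Lemma bipartite_square (T : Type) (L : eqType) (e g : T -> L)
    (X Y : T -> Prop) (x1 x2 : T) :
  (forall x y, X x -> Y y -> e x = e y \/ g x = g y) ->
  X x1 -> X x2 -> e x1 <> e x2 -> g x1 <> g x2 -> bipartite_spec e g X Y.
Proof.
move=> XY X1 X2 e12 g12.
have Yside y : Y y -> e y = e x1 /\ g y = g x2 \/ e y = e x2 /\ g y = g x1.
  move=> Yy; have := XY _ _ X1 Yy; have := XY _ _ X2 Yy.
  by move=> [h|h] [k|k]; [congruence|right|left|congruence].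
have [Ha|[y2 Hy2]] := forall_or_counterexample
    (fun y => Y y -> e y = e x1 /\ g y = g x2).
  by apply: (@BipCellY _ _ e g X Y (e x1) (g x2)) => y /Ha.
have [Hb|[y1 Hy1]] := forall_or_counterexample
    (fun y => Y y -> e y = e x2 /\ g y = g x1).
  by apply: (@BipCellY _ _ e g X Y (e x2) (g x1)) => y /Hb.
move/not_implyP: Hy1 => [Y1 ny1]; move/not_implyP: Hy2 => [Y2 ny2].
have [y1E|//] := Yside _ Y1; have [//|y2E] := Yside _ Y2.
apply: (@BipSquare _ _ e g X Y x1 x2 y1 y2) => // x Xx.
have := XY _ _ Xx Y1; have := XY _ _ Xx Y2.
case: y1E => -> ->; case: y2E => -> ->.
by move=> [h|h] [k|k]; [congruence|right|left|congruence].
Qed.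

Lemma bipartite_cases (T : Type) (L : eqType) (e g : T -> L) (X Y : T -> Prop) x0 :
  X x0 ->
  (forall x y, X x -> Y y -> e x = e y \/ g x = g y) -> bipartite_spec e g X Y.
Proof.
move=> X0 XY.
have [HX|[[x1 x2] HX]] := forall_or_counterexample
  (fun p : T * T => X p.1 -> X p.2 -> e p.1 = e p.2 \/ g p.1 = g p.2); last first.
  move: HX => /= /not_implyP[X1 /not_implyP[X2 /not_orP[]]].
  exact: bipartite_square.
have [HY|[[y1 y2] HY]] := forall_or_counterexample
  (fun p : T * T => Y p.1 -> Y p.2 -> e p.1 = e p.2 \/ g p.1 = g p.2); last first.
  move: HY => /= /not_implyP[Y1 /not_implyP[Y2 /not_orP[e12 g12]]].
  have YX x y : Y x -> X y -> e x = e y \/ g x = g y.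
    by move=> Yx Xy; have [->|->] := XY _ _ Xy Yx; [left|right].
  have [a h|a h|a b h|a b h|z1 z2 t1 t2 [? ? ? ?] ? ? h [[? ?] [? ?]] k] :=
    bipartite_square YX Y1 Y2 e12 g12.
  - by apply: (@BipLeft _ _ e g X Y (a)) => v ?; apply: h; tauto.
  - by apply: (@BipRight _ _ e g X Y (a)) => v ?; apply: h; tauto.
  - by apply: (@BipCellY _ _ e g X Y (a) (b)).
  - by apply: (@BipCellX _ _ e g X Y (a) (b)).
  - apply: (@BipSquare _ _ e g X Y t1 t2 z1 z2) => //;
      try congruence.
    + by move=> x /k; intuition congruence.
    + by move=> x /h; intuition congruence.
(* All pairs in the union now share a label. When two equivalence relations together relate all
   pairs, one of them already does. *)
have clique u v : X u \/ Y u -> X v \/ Y v -> e u = e v \/ g u = g v.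
  move=> [Xu|Yu] [Xv|Yv]; [exact: (HX (u, v))|exact: XY| |exact: (HY (u, v))].
  by have [->|->] := XY _ _ Xv Yu; [left|right].
have [H|[u Hu]] := forall_or_counterexample (fun v => X v \/ Y v -> e v = e x0).
  exact: (@BipLeft _ _ e g X Y (e x0) H).
move/not_implyP: Hu => [XYu eu].
have g0 : g u = g x0 by have [|//] := clique u x0 XYu (or_introl X0).
apply: (@BipRight _ _ e g X Y (g x0)) => v XYv.
have [ev|//] := clique v x0 XYv (or_introl X0).
have [ev'|gv] := clique v u XYv XYu; congruence.
Qed.

(** * Vertex labels of the components *)

Ltac permute U :=
  match type of U with is_true (uniq ?s) =>
    rewrite (@perm_uniq _ _ s) //; apply/permP => p /=; clear; lia
  end.

Section Structure.

Variables (T : Type) (L : eqType) (f : 'I_4 -> T -> L).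

Hypothesis cover : forall i j k l, uniq [:: i; j; k; l] ->
  forall u v, [\/ f i u = f i v, f j u = f j v, f k u = f k v | f l u = f l v].

Hypothesis uncovered2 : forall i j a b, exists v, f i v <> a /\ f j v <> b.

(* Two choices of components at once, because some cases need the average of two
   bounds: (10, 4) amounts to K = 5, r = 2 and (16, 2) to K = 8, r = 1. *)
Hypothesis design : forall i j k l, uniq [:: i; j; k; l] ->
  forall (xi xj xk xl yi yj yk yl : seq L) (K r : nat),
  (K, r) \in [:: (10, 4); (16, 2)] -> 0 < size xi ->
  (size xi + size xj + size xk + size xl) +
    (size yi + size yj + size yk + size yl) <= K ->
  (forall v,
    ((f i v \notin xi) + (f j v \notin xj) + (f k v \notin xk)
       + (f l v \notin xl)) +
    ((f i v \notin yi) + (f j v \notin yj) + (f k v \notin yk)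
       + (f l v \notin yl)) <= r) -> False.

Lemma design5 i j k l (xi xj xk xl : seq L) : uniq [:: i; j; k; l] ->
  0 < size xi -> size xi + size xj + size xk + size xl <= 5 ->
  (forall v, (f i v \notin xi) + (f j v \notin xj) + (f k v \notin xk)
               + (f l v \notin xl) <= 2) -> False.
Proof.
move=> U x0 sz le2; apply: (design (K := 10) (r := 4) U _ x0 (leq_add sz sz)) => //.
by move=> v; exact: leq_add (le2 v) (le2 v).
Qed.

Lemma design8 i j k l (xi xj xk xl : seq L) : uniq [:: i; j; k; l] ->
  0 < size xi -> size xi + size xj + size xk + size xl <= 8 ->
  (forall v, (f i v \notin xi) + (f j v \notin xj) + (f k v \notin xk)
               + (f l v \notin xl) <= 1) -> False.
Proof.
move=> U x0 sz le1; apply: (design (K := 16) (r := 2) U _ x0 (leq_add sz sz)) => //.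
by move=> v; exact: leq_add (le1 v) (le1 v).
Qed.

(** * Covers by three components of different colours *)

Ltac share U u v := case: (cover U u v) => ?; congruence.

Ltac split_eq := repeat (case: eqP => //= ?).

Ltac pick h := by move: h; split_eq.

Ltac tests := rewrite ?inE; repeat (case: (_ == _) => //=).

(* In the next lemmas the classes b, c, d of colours j, k, l cover everything. In
   the names of facts, B stands for the part that only b covers (likewise C, D),
   Ocd for the part that exactly c and d cover, C' and WC for the parts of C inside
   and outside the class a. *)
Lemma private_in_two_classes i j k l b c d a1 a2 : uniq [:: i; j; k; l] ->
  (forall v, [|| f j v == b, f k v == c | f l v == d]) ->
  (forall v, [|| f k v == c, f l v == d, f i v == a1 | f i v == a2]) ->
  (forall v, [|| f j v == b, f l v == d, f i v == a1 | f i v == a2]) ->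
  (forall v, [|| f j v == b, f k v == c, f i v == a1 | f i v == a2]) -> False.
Proof.
move=> U hV hB hC hD.
(* This is K = 5, r = 2: a vertex in only one of [b], [c], [d] also lies in [a1] or [a2], so at most
   two colours miss it. *)
apply: (design5 (xi := [:: a1; a2]) (xj := [:: b]) (xk := [:: c])
  (xl := [:: d]) U) => // v.
by move: (hV v) (hB v) (hC v) (hD v); tests.
Qed.

(** A vertex [w] in exactly [b] and [c] would pull D into its class of colour [i], leaving two
    classes of that colour for all private parts. Without such [w], the classes of [p] in colours
    [k] and [j] contain B and C respectively, and both contain the part of D outside [a]; two
    choices are then averaged. *)
Lemma two_privates_in_class i j k l b c d a p : uniq [:: i; j; k; l] ->
  (forall v, [|| f j v == b, f k v == c | f l v == d]) ->
  (forall v, [|| f k v == c, f l v == d | f i v == a]) ->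
  (forall v, [|| f j v == b, f l v == d | f i v == a]) ->
  f j p <> b -> f k p <> c -> f i p <> a -> False.
Proof.
move=> U hV hB hC pj pk pi.
have pl : f l p = d by pick (hV p).
have [z [zk zl]] := uncovered2 k l c d.
have zi : f i z = a by pick (hB z).
have zj : f j z = b by pick (hV z).
have [q [qj ql]] := uncovered2 j l b d.
have qi : f i q = a by pick (hC q).
have qk : f k q = c by pick (hV q).
have Ocd v : [|| f j v == b, f k v != c, f l v != d | f i v == a].
  by split_eq; share U z v.
have Obd v : [|| f k v == c, f j v != b, f l v != d | f i v == a].
  by split_eq; share U q v.
have [HObc|[w /negP Hw]] := forall_or_counterexample
  (fun v => [|| f l v == d, f j v != b | f k v != c]); last first.
  have [wl wj wk] : [/\ f l w <> d, f j w = b & f k w = c] by pick Hw.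
  have pw : f i p = f i w by share U p w.
  apply: (private_in_two_classes (a1 := a) (a2 := f i p) U hV) => v.
  - by move: (hB v); tests.
  - by move: (hC v); tests.
  - by move: (hV v); split_eq; share U v w.
have zp : f k z = f k p by share U z p.
have qp : f j q = f j p by share U q p.
have Bop v : [|| f k v == c, f l v == d | f k v == f k p].
  by move: (hB v) (hV v); split_eq; share U v p.
have Cop v : [|| f j v == b, f l v == d | f j v == f j p].
  by move: (hC v) (hV v); split_eq; share U v p.
have WDk v : [|| f j v == b, f k v == c, f i v == a | f k v == f k p].
  by move: (hV v); split_eq; share U z v.
have WDj v : [|| f j v == b, f k v == c, f i v == a | f j v == f j p].
  by move: (hV v); split_eq; share U q v.
apply: (design (xi := [:: a]) (xj := [:: b; f j p]) (xk := [:: c; f k p])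
  (xl := [:: d]) (yi := [:: a]) (yj := [::]) (yk := [::]) (yl := [:: d])
  (K := 10) (r := 4) U) => // v.
move: (hV v) (hB v) (hC v) (Ocd v) (Obd v) (HObc v) (Bop v) (Cop v) (WDk v) (WDj v).
by tests.
Qed.

(** Vertices [w] in exactly [b] and [c], and [w'] in exactly [b] and [d], force D and C into single
    classes of colour [i]. If these differ, each of the colours [j], [k], [l] has one further class
    that contains the two private parts outside its chosen class. *)
Lemma private_misses_class i j k l b c d a p : uniq [:: i; j; k; l] ->
  (forall v, [|| f j v == b, f k v == c | f l v == d]) ->
  (forall v, [|| f k v == c, f l v == d | f i v == a]) ->
  (forall v, [|| f j v == b, f l v == d | f i v != a]) ->
  f j p <> b -> f k p <> c -> f i p <> a -> False.
Proof.
move=> U hV hB hC pj pk pi.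
have pl : f l p = d by pick (hV p).
have [z [zk zl]] := uncovered2 k l c d.
have zi : f i z = a by pick (hB z).
have zj : f j z = b by pick (hV z).
have [q [qj ql]] := uncovered2 j l b d.
have qi : f i q <> a by pick (hC q).
have qk : f k q = c by pick (hV q).
have zq : f l z = f l q by share U z q.
have zp : f k z = f k p by share U z p.
have [w [wl wq]] := uncovered2 l l d (f l q).
have wj : f j w = b by move: (hV w) (hC w); split_eq; share U z w.
have wk : f k w = c by move: (hB w); split_eq; share U q w.
have pw : f i p = f i w by share U p w.
have hDi v : [|| f j v == b, f k v == c | f i v == f i p].
  by move: (hV v); split_eq; share U v w.
have [w' [w'k w'p]] := uncovered2 k k c (f k p).
have w'j : f j w' = b by move: (hV w') (hDi w'); split_eq; share U z w'.
have w'l : f l w' = d by move: (hB w'); split_eq; share U p w'.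
have qw : f i q = f i w' by share U q w'.
have hCi v : [|| f j v == b, f l v == d | f i v == f i q].
  by move: (hV v); split_eq; share U v w'.
case: (f i p =P f i q) => [pq|npq].
  apply: (private_in_two_classes (a1 := a) (a2 := f i p) U hV) => v.
  - by move: (hB v); tests.
  - by move: (hCi v); rewrite -pq; tests.
  - by move: (hDi v); tests.
have pq : f j p = f j q by share U p q.
have Bk v : [|| f k v == c, f l v == d | f k v == f k p].
  by move: (hB v) (hV v); split_eq; share U v p.
have Bl v : [|| f k v == c, f l v == d | f l v == f l q].
  by move: (hB v) (hV v); split_eq; share U v q.
have Cj v : [|| f j v == b, f l v == d | f j v == f j p].
  by move: (hCi v) (hV v); split_eq; share U v p.
have Cl v : [|| f j v == b, f l v == d | f l v == f l q].
  by move: (hCi v) (hV v); split_eq; share U v z.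
have Dj v : [|| f j v == b, f k v == c | f j v == f j p].
  by move: (hDi v) (hV v); split_eq; share U v q.
have Dk v : [|| f j v == b, f k v == c | f k v == f k p].
  by move: (hDi v) (hV v); split_eq; share U v z.
have Ocd v : [|| f j v == b, f k v != c, f l v != d | f i v == a].
  by split_eq; share U z v.
have Obd v : [|| f k v == c, f j v != b, f l v != d | f i v == f i q].
  by split_eq; share U q v.
have Obc v : [|| f l v == d, f j v != b, f k v != c | f i v == f i p].
  by split_eq; share U p v.
apply: (design (xi := [:: a; f i p; f i q]) (xj := [:: b]) (xk := [:: c])
  (xl := [:: d]) (yi := [:: a; f i p; f i q]) (yj := [:: b; f j p])
  (yk := [:: c; f k p]) (yl := [:: d; f l q]) (K := 16) (r := 2) U) => // v.
move: (hV v) (hB v) (hCi v) (hDi v) (Ocd v) (Obd v) (Obc v).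
by move: (Bk v) (Bl v) (Cj v) (Cl v) (Dj v) (Dk v); tests.
Qed.

(** The cases where C or D lies inside [a] or avoids it are settled above. Otherwise [a] cuts both;
    then no vertex lies in exactly [b] and [d] or exactly [b] and [c], since it would share colour
    [i] with both sides of the cut, and a choice with K = 8, r = 1 exists. *)
Lemma cover3_private_in_class i j k l b c d a : uniq [:: i; j; k; l] ->
  (forall v, [|| f j v == b, f k v == c | f l v == d]) ->
  (forall v, [|| f k v == c, f l v == d | f i v == a]) -> False.
Proof.
move=> U hV hB.
have U' : uniq [:: i; j; l; k] by permute U.
have hV' v : [|| f j v == b, f l v == d | f k v == c] by move: (hV v); tests.
have hB' v : [|| f l v == d, f k v == c | f i v == a] by move: (hB v); tests.
have [hC|[q /negP Hq]] := forall_or_counterexample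
    (fun v => [|| f j v == b, f l v == d | f i v == a]).
  have [hD|[p /negP Hp]] := forall_or_counterexample
    (fun v => [|| f j v == b, f k v == c | f i v == a]).
    apply: (private_in_two_classes (a1 := a) (a2 := a) U hV) => v.
    - by move: (hB v); tests.
    - by move: (hC v); tests.
    - by move: (hD v); tests.
  by apply: (two_privates_in_class (p := p) U hV hB hC); pick Hp.
have [qj ql qi] : [/\ f j q <> b, f l q <> d & f i q <> a] by pick Hq.
have [hD|[p /negP Hp]] := forall_or_counterexample
    (fun v => [|| f j v == b, f k v == c | f i v == a]).
  exact: (two_privates_in_class (p := q) U' hV' hB' hD).
have [pj pk pi] : [/\ f j p <> b, f k p <> c & f i p <> a] by pick Hp.
have [hC|[c1 /negP Hc1]] := forall_or_counterexample
    (fun v => [|| f j v == b, f l v == d | f i v != a]).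
  exact: (private_misses_class (p := p) U hV hB hC).
have [hD|[d1 /negP Hd1]] := forall_or_counterexample
    (fun v => [|| f j v == b, f k v == c | f i v != a]).
  exact: (private_misses_class (p := q) U' hV' hB' hD).
have [c1j c1l c1i] : [/\ f j c1 <> b, f l c1 <> d & f i c1 = a] by pick Hc1.
have [d1j d1k d1i] : [/\ f j d1 <> b, f k d1 <> c & f i d1 = a] by pick Hd1.
have pl : f l p = d by pick (hV p).
have qk : f k q = c by pick (hV q).
have c1k : f k c1 = c by pick (hV c1).
have d1l : f l d1 = d by pick (hV d1).
have [z [zk zl]] := uncovered2 k l c d.
have zi : f i z = a by pick (hB z).
have zj : f j z = b by pick (hV z).
have zq : f l z = f l q by share U z q.
have zp : f k z = f k p by share U z p.
have c1p : f j c1 = f j p by share U c1 p.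
have d1q : f j d1 = f j q by share U d1 q.
have Bk v : [|| f k v == c, f l v == d | f k v == f k p].
  by move: (hB v) (hV v); split_eq; share U v p.
have Bl v : [|| f k v == c, f l v == d | f l v == f l q].
  by move: (hB v) (hV v); split_eq; share U v q.
have Obd v : [|| f k v == c, f j v != b | f l v != d].
  split_eq; have ? : f i c1 = f i v by share U c1 v.
  by share U q v.
have Obc v : [|| f l v == d, f j v != b | f k v != c].
  split_eq; have ? : f i d1 = f i v by share U d1 v.
  by share U p v.
have Ocd v : [|| f j v == b, f k v != c, f l v != d | f i v == a].
  by split_eq; share U z v.
have C'j v : [|| f j v == b, f l v == d, f i v != a | f j v == f j p].
  by move: (hV v); split_eq; share U v p.
have WCj v : [|| f j v == b, f l v == d, f i v == a | f j v == f j q].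
  by move: (hV v); split_eq; share U v d1.
have WCl v : [|| f j v == b, f l v == d, f i v == a | f l v == f l q].
  by move: (hV v); split_eq; share U v z.
have D'j v : [|| f j v == b, f k v == c, f i v != a | f j v == f j q].
  by move: (hV v); split_eq; share U v q.
have WDj v : [|| f j v == b, f k v == c, f i v == a | f j v == f j p].
  by move: (hV v); split_eq; share U v c1.
have WDk v : [|| f j v == b, f k v == c, f i v == a | f k v == f k p].
  by move: (hV v); split_eq; share U v z.
apply: (design8 (xi := [:: a]) (xj := [:: b; f j p; f j q]) (xk := [:: c; f k p])
  (xl := [:: d; f l q]) U) => // v.
move: (hV v) (hB v) (Ocd v) (Obd v) (Obc v) (Bk v) (Bl v).
by move: (C'j v) (WCj v) (WCl v) (D'j v) (WDj v) (WDk v); tests.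
Qed.

(** No private part fits into one class of colour [i]. Vertices of B and C can only share colours
    [i] and [l], so the square is the only outcome left, and it puts both parts into the same two
    classes of colour [i]. *)
Lemma cover3_privates_split i j k l b c d : uniq [:: i; j; k; l] ->
  (forall v, [|| f j v == b, f k v == c | f l v == d]) ->
  exists x1 x2 : T, [/\ f i x1 <> f i x2,
    (f k x1 <> c /\ f l x1 <> d) /\ (f k x2 <> c /\ f l x2 <> d),
    forall v, [|| f k v == c, f l v == d, f i v == f i x1 | f i v == f i x2]
  & forall v, [|| f j v == b, f l v == d, f i v == f i x1 | f i v == f i x2]].
Proof.
move=> U hV.
have Uk : uniq [:: i; k; j; l] by permute U.
have Ul : uniq [:: i; l; j; k] by permute U.
have hVk v : [|| f k v == c, f j v == b | f l v == d] by move: (hV v); tests.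
have hVl v : [|| f l v == d, f j v == b | f k v == c] by move: (hV v); tests.
have nB := cover3_private_in_class U hV.
have nC := cover3_private_in_class Uk hVk.
have nD := cover3_private_in_class Ul hVl.
have Obc v : [|| f l v == d, f j v != b | f k v != c].
  split_eq; exfalso; apply: (nD (f i v)) => u.
  by move: (hV u); split_eq; share U u v.
have [z [zk zl]] := uncovered2 k l c d.
have zB : f k z <> c /\ f l z <> d by [].
have := @bipartite_cases _ _ (f i) (f l) (fun v => f k v <> c /\ f l v <> d)
  (fun v => f j v <> b /\ f l v <> d) z zB.
case=> [x y [xk xl] [yj yl]|a h|a h|a a' h|a a' h|x1 x2 y1 y2 [X1 X2 _ _] i12 _ hX _ hY].
- have ? : f j x = b by pick (hV x).
  have ? : f k y = c by pick (hV y).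
  by case: (cover U x y) => ?; [left|congruence|congruence|right].
- by case: (nB a) => v; split_eq; have := h v; tauto.
(* A single class of colour [l] on B and C would cover everything together with [d], since [b] and
   [c] meet only inside [d]. *)
- have [v [vd va]] := uncovered2 l l d a.
  by case: va; apply: h; move: (Obc v) (hV v); split_eq; tauto.
- by case: (nB a) => v; split_eq; have := h v; tauto.
- by case: (nC a) => v; split_eq; have := h v; tauto.
exists x1, x2; split => // v; split_eq.
- by have := hX v; tauto.
- by have := hY v; tauto.
Qed.

(** The two classes of colour [i] that contain B and C are also those that contain B and D, because
    B meets both. So they contain all private parts. *)
Lemma cover3_impossible i j k l b c d : uniq [:: i; j; k; l] ->
  (forall v, [|| f j v == b, f k v == c | f l v == d]) -> False.
Proof.
move=> U hV.
have U' : uniq [:: i; j; l; k] by permute U.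
have hV' v : [|| f j v == b, f l v == d | f k v == c] by move: (hV v); tests.
have [x1 [x2 [x12 [[k1 l1] [k2 l2]] hB hC]]] := cover3_privates_split U hV.
have [y1 [y2 [y12 _ hB' hD]]] := cover3_privates_split U' hV'.
apply: (private_in_two_classes (a1 := f i x1) (a2 := f i x2) U hV) => // v.
move: (hB' x1) (hB' x2) (hD v); split_eq; congruence.
Qed.

(** * Components of different colours meet *)

(** Otherwise a vertex sharing colour [i] with [x] also shares colour [j], and the classes of [x] in
    the other three colours cover everything. *)
Lemma class_not_in_class i j k l x : uniq [:: i; j; k; l] ->
  exists v, f i v = f i x /\ f j v <> f j x.
Proof.
move=> U; have [h|[v /not_implyP[vi vj]]] := forall_or_counterexample
    (fun v => f i v = f i x -> f j v = f j x); last by exists v.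
exfalso; apply: (cover3_impossible (b := f j x) (c := f k x) (d := f l x) U) => v.
by split_eq; case: (cover U v x) => [/h|||]; congruence.
Qed.

Lemma classes_meet i j k l x y : uniq [:: i; j; k; l] ->
  exists v, f i v = f i x /\ f j v = f j y.
Proof.
move=> U; have [|ne] := EM (exists v, f i v = f i x /\ f j v = f j y) => //.
have disj v : f i v = f i x -> f j v = f j y -> False by move=> *; apply: ne; exists v.
exfalso.
(* Disjoint classes of different colours are joined by the other two colours alone; neither lies in
   a class of another colour, so only the square survives. *)
have square i' j' k' l' x' y' : uniq [:: i'; j'; k'; l'] ->
    (forall v, f i' v = f i' x' -> f j' v = f j' y' -> False) ->
    exists x1 x2 y1 y2, [/\ [/\ f i' x1 = f i' x', f i' x2 = f i' x',
       f j' y1 = f j' y' & f j' y2 = f j' y'],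
     f k' x1 <> f k' x2, f l' x1 <> f l' x2 ,
     (f k' y1 = f k' x1 /\ f l' y1 = f l' x2) /\ (f k' y2 = f k' x2 /\ f l' y2 = f l' x1)
    & [/\ forall v, f i' v = f i' x' ->
         f k' v = f k' x1 /\ f l' v = f l' x1 \/ f k' v = f k' x2 /\ f l' v = f l' x2 &
         forall v, f j' v = f j' y' ->
         f k' v = f k' x1 /\ f l' v = f l' x2 \/ f k' v = f k' x2 /\ f l' v = f l' x1]].
  move=> V dis.
  have Vk : uniq [:: i'; k'; j'; l'] by permute V.
  have Vl : uniq [:: i'; l'; j'; k'] by permute V.
  have Vj : uniq [:: j'; k'; i'; l'] by permute V.
  have := @bipartite_cases _ _ (f k') (f l') (fun v => f i' v = f i' x')
    (fun v => f j' v = f j' y') x' erefl.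
  case=> [u v ui vj|a h|a h|a b h|a b h|x1 x2 y1 y2 Xs k12 l12 hX hy hY].
  - by case: (cover V u v) => ?; [case: (dis v)|case: (dis u)|left|right]; congruence.
  - have [v [vi vk]] := class_not_in_class x' Vk.
    by case: vk; rewrite !h //; left.
  - have [v [vi vl]] := class_not_in_class x' Vl.
    by case: vl; rewrite !h //; left.
  - have [v [vi vk]] := class_not_in_class x' Vk.
    by case: vk; rewrite (h v vi).1 (h x' erefl).1.
  - have [v [vj vk]] := class_not_in_class y' Vj.
    by case: vk; rewrite (h v vj).1 (h y' erefl).1.
  - by exists x1, x2, y1, y2.
have [x1 [x2 [y1 [y2 [[x1i x2i y1j y2j] k12 l12 [[y1k y1l] [y2k y2l]] [hX hY]]]]]] :=
  square _ _ _ _ _ _ U disj.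
have U1 : uniq [:: i; k; j; l] by permute U.
have U2 : uniq [:: j; k; i; l] by permute U.
have U3 : uniq [:: i; l; j; k] by permute U.
have U4 : uniq [:: j; l; i; k] by permute U.
(* The classes of colour k outside those of x1, x2 are disjoint from both given
   classes, so they too are in square position with them. *)
have offk v : f k v <> f k x1 -> f k v <> f k x2 ->
  [/\ f l v = f l x1 \/ f l v = f l x2, f j v = f j x1 \/ f j v = f j x2,
      f i v = f i y1 \/ f i v = f i y2 & f j x1 <> f j x2 /\ f i y1 <> f i y2].
  move=> v1 v2.
  have d1 u : f i u = f i x -> f k u = f k v -> False.
    by move=> /hX[[? ?]|[? ?]]; congruence.
  have d2 u : f j u = f j y -> f k u = f k v -> False.
    by move=> /hY[[? ?]|[? ?]]; congruence.
  have [s1 [s2 [t1 [t2 [_ s12 s12' _ [hs ht]]]]]] := square _ _ _ _ _ _ U1 d1.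
  have [s3 [s4 [t3 [t4 [_ s34 s34' _ [hs' ht']]]]]] := square _ _ _ _ _ _ U2 d2.
  move: (hs _ x1i) (hs _ x2i) (hs' _ y1j) (hs' _ y2j) (ht v erefl) (ht' v erefl).
  do 6 (case=> [[? ?]|[? ?]]); try (exfalso; congruence);
    by repeat split; first [congruence | left; congruence | right; congruence].
have offl v : f l v <> f l x1 -> f l v <> f l x2 ->
  [/\ f k v = f k x1 \/ f k v = f k x2, f j v = f j x1 \/ f j v = f j x2
    & f i v = f i y1 \/ f i v = f i y2].
  move=> v1 v2.
  have d1 u : f i u = f i x -> f l u = f l v -> False.
    by move=> /hX[[? ?]|[? ?]]; congruence.
  have d2 u : f j u = f j y -> f l u = f l v -> False.
    by move=> /hY[[? ?]|[? ?]]; congruence.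
  have [s1 [s2 [t1 [t2 [_ s12 s12' _ [hs ht]]]]]] := square _ _ _ _ _ _ U3 d1.
  have [s3 [s4 [t3 [t4 [_ s34 s34' _ [hs' ht']]]]]] := square _ _ _ _ _ _ U4 d2.
  move: (hs _ x1i) (hs _ x2i) (hs' _ y1j) (hs' _ y2j) (ht v erefl) (ht' v erefl).
  do 6 (case=> [[? ?]|[? ?]]); try (exfalso; congruence);
    by repeat split; first [congruence | left; congruence | right; congruence].
have [w [w1 w2]] := uncovered2 k k (f k x1) (f k x2).
have [_ _ _ [j12 i12]] := offk w w1 w2.
(* The class of [w] in colour [k] is disjoint from the class of [x], and the square for this pair
   spreads the latter over just two classes of colour [j]. *)
have hX' v : f i v = f i x -> f j v = f j x1 \/ f j v = f j x2.
  move=> vi; have d u : f i u = f i x -> f k u = f k w -> False.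
    by move=> /hX[[? ?]|[? ?]]; congruence.
  have [s1 [s2 [t1 [t2 [_ s12 s12' _ [hs _]]]]]] := square _ _ _ _ _ _ U1 d.
  move: (hs _ x1i) (hs _ x2i) (hs _ vi).
  by do 3 (case=> [[? ?]|[? ?]]);
    first [exfalso; congruence | left; congruence | right; congruence].
have hY' v : f j v = f j y -> f i v = f i y1 \/ f i v = f i y2.
  move=> vj; have d u : f j u = f j y -> f k u = f k w -> False.
    by move=> /hY[[? ?]|[? ?]]; congruence.
  have [s1 [s2 [t1 [t2 [_ s12 s12' _ [hs _]]]]]] := square _ _ _ _ _ _ U2 d.
  move: (hs _ y1j) (hs _ y2j) (hs _ vj).
  by do 3 (case=> [[? ?]|[? ?]]);
    first [exfalso; congruence | left; congruence | right; congruence].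
(* Two classes of each colour give K = 8. A vertex missed in colour [k] or [l] is caught in the
   other three, and [ijv] excludes missing [i] and [j] together. *)
apply: (design8 (xi := [:: f i y1; f i y2]) (xj := [:: f j x1; f j x2])
  (xk := [:: f k x1; f k x2]) (xl := [:: f l x1; f l x2]) U) => // v.
have kv : [|| f k v == f k x1, f k v == f k x2 |
    [&& (f l v == f l x1) || (f l v == f l x2), (f j v == f j x1) || (f j v == f j x2)
      & (f i v == f i y1) || (f i v == f i y2)]].
  case: (f k v =P f k x1) => //= v1; case: (f k v =P f k x2) => //= v2.
  have [hl hj hi _] := offk v v1 v2.
  by case: hl => ->; case: hj => ->; case: hi => ->; rewrite !eqxx ?orbT.
have lv : [|| f l v == f l x1, f l v == f l x2 |
    [&& (f k v == f k x1) || (f k v == f k x2), (f j v == f j x1) || (f j v == f j x2)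
      & (f i v == f i y1) || (f i v == f i y2)]].
  case: (f l v =P f l x1) => //= v1; case: (f l v =P f l x2) => //= v2.
  have [hk hj hi] := offl v v1 v2.
  by case: hk => ->; case: hj => ->; case: hi => ->; rewrite !eqxx ?orbT.
have ijv : [|| f i v == f i y1, f i v == f i y2, f j v == f j x1 | f j v == f j x2].
  (* Such a vertex shares colour [k] or [l] with all four corners. Sharing with [x1] and [x2] puts
     it in the cell of [y1] or of [y2], which has nothing in common with the other one. *)
  split_eq; have vi : f i v <> f i x by move/hX'; case; congruence.
  have vj : f j v <> f j y by move/hY'; case; congruence.
  case: (cover U v x1) => ?; try congruence; case: (cover U v x2) => ?; try congruence;
  by case: (cover U v y1) => ?; try congruence; case: (cover U v y2) => ?; congruence.
by move: kv lv ijv; tests.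
Qed.

End Structure.

(** * Counting edges *)

Local Open Scope ring_scope.

Section Counting.

Variables (R : realFieldType).

(* Uses [min(1, a^2) <= (a + 1) / 2] and [min(1, a^2) <= (3 a - 1) / 2] when
   [a > 1/2], and [a^2 <= a / 2] otherwise; [k] counts the terms with [a > 1/2]. *)
Lemma sum_waste (I : finType) (P : pred I) (a phi : I -> R) :
  (forall x, 0 <= a x) -> (forall x, phi x < 1) -> (forall x, phi x <= a x ^+ 2) ->
  exists k : nat, \sum_(x | P x) phi x <= (\sum_(x | P x) a x + k%:R) / 2 /\
    \sum_(x | P x) phi x <= (3 * \sum_(x | P x) a x - k%:R) / 2.
Proof.
move=> a_ge0 phi_lt1 phi_sq.
exists (\sum_(x | P x) (2^-1 < a x)%R)%N; rewrite natr_sum; split.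
  rewrite -big_split /= mulr_suml; apply: ler_sum => x _.
  have := a_ge0 x; have := phi_lt1 x; have := phi_sq x; rewrite expr2.
  case: (ltP 2^-1 (a x)) => h /= *; [have [?|?] := lerP (a x) 1|]; nra.
rewrite mulr_sumr -sumrB mulr_suml; apply: ler_sum => x _.
have := a_ge0 x; have := phi_lt1 x; have := phi_sq x; rewrite expr2.
case: (ltP 2^-1 (a x)) => h /= *; [have [?|?] := lerP (a x) 1|]; nra.
Qed.

Variables (T : finType) (f : 'I_4 -> T -> {set T}).
Hypothesis mem_class : forall i u v, (u \in f i v) = (f i u == f i v).

Lemma class_partition i (P : pred {set T}) :
  (\sum_(X in [set f i v | v : T] | P X) #|X| = #|[set v | P (f i v)]|)%N.
Proof.
rewrite -[RHS]sum1_card.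
rewrite (partition_big (f i) (fun X => (X \in [set f i v | v : T]) && P X)) /=;
  last first.
  by move=> v; rewrite inE => ->; rewrite imset_f.
apply: eq_bigr => _ /andP[/imsetP[v _ ->] Pv]; rewrite -sum1_card.
by apply: eq_bigl => u; rewrite mem_class inE; case: eqP => [->|]; rewrite ?Pv ?andbF.
Qed.

Variables (w N : R) (phi : 'I_4 -> {set T} -> R) (s : 'I_4 -> R).
Hypothesis NE : w * #|T|%:R = N.
Hypothesis w_ge0 : 0 <= w.
Hypothesis phi_lt1 : forall i X, phi i X < 1.
Hypothesis phi_sq : forall i X, phi i X <= (w * #|X|%:R) ^+ 2.
Hypothesis N2 : N * N = 5 + 2 * N.
Hypothesis N_gt3 : 3 < N.
Hypothesis N_lt : N < 7 / 2.
Hypothesis sE : forall i, s i = \sum_(X in [set f i v | v : T]) phi i X.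
Hypothesis total : N * N <= \sum_i s i.

Let mu_ge0 (X : {set T}) : 0 <= w * #|X|%:R.
Proof. exact: mulr_ge0. Qed.

Let phi_le i X : phi i X <= w * #|X|%:R.
Proof.
have := phi_lt1 i X; have := phi_sq i X; have := mu_ge0 X; rewrite expr2.
by have [?|?] := lerP (w * #|X|%:R) 1; nra.
Qed.

Lemma weight_outside i (xs : seq {set T}) :
  \sum_(X in [set f i v | v : T] | X \notin xs) phi i X
    <= w * #|[set v | f i v \notin xs]|%:R.
Proof.
rewrite -(class_partition i (fun X => X \notin xs)) natr_sum mulr_sumr.
by apply: ler_sum => X _; exact: phi_le.
Qed.

(** Strictness also holds when no entry of [xs] is a class: the sum is then empty while [xs] is
    not. *)
Lemma weight_inside i (xs : seq {set T}) : (0 < size xs)%N ->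
  \sum_(X in [set f i v | v : T] | X \in xs) phi i X < (size xs)%:R.
Proof.
move=> xs_gt0; set Q := [set X in [set f i v | v : T] | X \in xs].
rewrite (eq_bigl (mem Q)) => [|X]; last by rewrite !inE.
have szQ : (#|Q| <= size xs)%N.
  apply: leq_trans (card_size xs); apply: subset_leq_card.
  by apply/subsetP => X; rewrite !inE => /andP[].
have [->|[X QX]] := set_0Vmem Q; first by rewrite big_set0 ltr0n.
apply: lt_le_trans (_ : #|Q|%:R <= _); last by rewrite ler_nat.
rewrite -sum1_card natr_sum (bigD1 X) //= [ltRHS](bigD1 X) //=.
by apply: ltr_leD; rewrite ?phi_lt1 //; apply: ler_sum => Y _; exact: ltW.
Qed.

Lemma weight_design_lt i (xs : seq {set T}) : (0 < size xs)%N ->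
  s i < (size xs)%:R + w * #|[set v | f i v \notin xs]|%:R.
Proof.
move=> xs_gt0; rewrite sE (bigID (mem xs)) /=.
by apply: ltr_leD; [exact: weight_inside|exact: weight_outside].
Qed.

Lemma weight_design i (xs : seq {set T}) :
  s i <= (size xs)%:R + w * #|[set v | f i v \notin xs]|%:R.
Proof.
have [xs0|/weight_design_lt/ltW//] := posnP (size xs).
have -> : xs = [::] by case: xs xs0.
rewrite add0r sE (eq_bigl (fun X => (X \in [set f i v | v : T]) && (X \notin [::]))).
  exact: weight_outside.
by move=> X; rewrite andbT.
Qed.

Lemma sum_four (F : 'I_4 -> R) i j k l : uniq [:: i; j; k; l] ->
  \sum_x F x = F i + F j + F k + F l.
Proof.
move=> U; rewrite -big_enum /= (perm_big [:: i; j; k; l]) /=.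
  by rewrite !big_cons big_nil addr0 !addrA.
apply: uniq_perm; rewrite ?enum_uniq // => x; rewrite mem_enum inE.
have /uniq_min_size := U; move=> /(_ (enum 'I_4)) [] //.
- by move=> y _; rewrite mem_enum.
- by rewrite size_enum_ord.
- by move=> _ /(_ x); rewrite mem_enum inE.
Qed.

(** Summing the misses over all vertices gives 2 N^2 < K + r N for the two choices together. As 2
    N^2 = 10 + 4 N, the pair (10, 4) is contradictory at once, and (16, 2) would need N < 3. *)
Lemma design_impossible i j k l : uniq [:: i; j; k; l] ->
  forall (xi xj xk xl yi yj yk yl : seq {set T}) (K r : nat),
  (K, r) \in [:: (10, 4); (16, 2)]%N -> (0 < size xi)%N ->
  ((size xi + size xj + size xk + size xl) +
    (size yi + size yj + size yk + size yl) <= K)%N ->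
  (forall v,
    ((f i v \notin xi) + (f j v \notin xj) + (f k v \notin xk)
       + (f l v \notin xl)) +
    ((f i v \notin yi) + (f j v \notin yj) + (f k v \notin yk)
       + (f l v \notin yl)) <= r)%N -> False.
Proof.
move=> U xi xj xk xl yi yj yk yl K r Kr x0 sz le_r.
have cardE i' (xs : seq {set T}) :
    (\sum_v (f i' v \notin xs))%N = #|[set v | f i' v \notin xs]|.
  by rewrite -sum1_card [RHS]big_mkcond; apply: eq_bigr => v _;
    rewrite inE; case: (_ \in _).
have : (\sum_v (((f i v \notin xi) + (f j v \notin xj) + (f k v \notin xk)
       + (f l v \notin xl)) +
    ((f i v \notin yi) + (f j v \notin yj) + (f k v \notin yk)
       + (f l v \notin yl))) <= r * #|T|)%N.
  have -> : (r * #|T| = \sum_(v : T) r)%N by rewrite sum_nat_const mulnC.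
  by apply: leq_sum => v _; exact: le_r.
rewrite !big_split /= !cardE => {}le_r.
have := weight_design_lt i x0; have := weight_design j xj.
have := weight_design k xk; have := weight_design l xl.
have := weight_design i yi; have := weight_design j yj.
have := weight_design k yk; have := weight_design l yl.
have := total; rewrite (sum_four s U) N2.
move: le_r sz; rewrite -(ler_nat R) -[(_ <= K)%N](ler_nat R) !natrD natrM.
move=> /(ler_wpM2l w_ge0); rewrite !mulrDr mulrCA NE.
by move: Kr N_gt3; rewrite !inE => /orP[]/eqP[-> ->] *; lra.
Qed.

(** For k at most 3 the first bound of [sum_waste] suffices. For k at least 4 the second gives (3 N
    - 4)/2, which is below (N + 3)/2 because N < 7/2. *)
Lemma weight_family_le i : s i <= (N + 3) / 2.
Proof.
have [k [le1 le2]] := @sum_waste _ (mem [set f i v | v : T])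
  (fun X => w * #|X|%:R) (phi i) mu_ge0 (phi_lt1 i) (phi_sq i).
have tE : \sum_(X in [set f i v | v : T]) w * #|X|%:R = N.
  rewrite -NE -mulr_sumr -natr_sum; congr (w * _%:R).
  have := class_partition i xpredT; rewrite (_ : [set v | true] = setT) ?cardsT.
    by move=> <-; apply: eq_bigl => X; rewrite andbT.
  by apply/setP => v; rewrite !inE.
rewrite tE in le1 le2; move: N_gt3 N_lt => ? ?; have [k3|k4] := leqP k 3.
  by move: k3 le1; rewrite -(ler_nat R) sE => *; lra.
by move: k4 le2; rewrite -(ler_nat R) sE => *; lra.
Qed.

(** The classes of colour [i] other than [x] and those of colour [j] other than [y] occupy disjoint
    sets, so their measures add up to at most N; [x] and [y] contribute less than 1 each. *)
Lemma weight_two_families_le i j x y : i != j ->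
  (forall v, f i v = x \/ f j v = y) -> s i + s j < 2 + (N + 3) / 2.
Proof.
move=> ij cov.
have split_off i' x' : exists2 t, t < 1 & exists k : nat,
    let m := w * #|[set v | f i' v != x']|%:R in
    s i' <= t + (m + k%:R) / 2 /\ s i' <= t + (3 * m - k%:R) / 2.
  have [k [le1 le2]] := @sum_waste _
    (fun X => (X \in [set f i' v | v : T]) && (X != x'))
    (fun X => w * #|X|%:R) (phi i') mu_ge0 (phi_lt1 i') (phi_sq i').
  exists (\sum_(X in [set f i' v | v : T] | X == x') phi i' X).
    rewrite (eq_bigl (fun X => (X \in [set f i' v | v : T]) && (X \in [:: x']))).
      exact: (@weight_inside i' [:: x']).
    by move=> X; rewrite inE.
  exists k => /=; rewrite sE [in X in X /\ _](bigID (pred1 x')) /=.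
  rewrite [in X in _ /\ X](bigID (pred1 x')) /=.
  by move: le1 le2; rewrite -mulr_sumr -natr_sum class_partition => *; lra.
have [t1 lt1 [k1 /= [a1 b1]]] := split_off i x.
have [t2 lt2 [k2 /= [a2 b2]]] := split_off j y.
have mN : w * #|[set v | f i v != x]|%:R + w * #|[set v | f j v != y]|%:R <= N.
  rewrite -NE -mulrDr -natrD ler_wpM2l // ler_nat -cardsUI.
  rewrite [X in (_ + X)%N]eq_card0 ?addn0.
    exact: max_card.
  by move=> v; rewrite !inE; have [->|->] := cov v; rewrite eqxx ?andbF.
move: N_gt3 N_lt => ? ?; have [k3|k4] := leqP (k1 + k2) 3.
  by move: k3; rewrite -(ler_nat R) natrD => *; lra.
by move: k4; rewrite -(ler_nat R) natrD => *; lra.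
Qed.

(** A cover would bound the total by 2 + 3 (N + 3)/2, whether or not [i = j], and this is less than
    N^2 = 5 + 2 N since N > 3. *)
Lemma two_classes_do_not_cover i j x y : exists v, f i v <> x /\ f j v <> y.
Proof.
have [|ne] := EM (exists v, f i v <> x /\ f j v <> y) => //.
have cov v : f i v = x \/ f j v = y.
  case: (f i v =P x); case: (f j v =P y); try tauto.
  by move=> ? ?; case: ne; exists v.
move: N_gt3 => ?; have card4 : #|'I_4| = 4 by rewrite card_ord.
have [ij|ij] := eqVneq i j.
  rewrite -{}ij in cov.
  have si : s i <= 2.
    have := weight_design i [:: x; y].
    rewrite (_ : [set v | _] = set0) ?cards0 ?mulr0 ?addr0 //.
    by apply/setP => v; rewrite !inE; have [->|->] := cov v; rewrite eqxx ?orbT.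
  have : \sum_(k < 4 | k != i) s k <= \sum_(k < 4 | k != i) ((N + 3) / 2).
    by apply: ler_sum => k _; exact: weight_family_le.
  rewrite sumr_const (cardC1 i) card4 /= -[_ *+ 3]mulr_natr => le3.
  by move: total; rewrite (bigD1 i) //= N2 => *; lra.
have := weight_two_families_le ij cov.
have : \sum_(k < 4 | (k != i) && (k != j)) s k
    <= \sum_(k < 4 | (k != i) && (k != j)) ((N + 3) / 2).
  by apply: ler_sum => k _; exact: weight_family_le.
have card2 : #|[pred k : 'I_4 | (k != i) && (k != j)]| = 2.
  rewrite (_ : #|_| = #|~: [set i; j]|); last first.
    by apply: eq_card => k; rewrite !inE negb_or.
  by have := cardsC [set i; j]; rewrite card4 cards2 ij; lia.
rewrite sumr_const card2 -[_ *+ 2]mulr_natr => *.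
by move: total; rewrite (bigD1 i) //= (bigD1 j) ?[j == i]eq_sym //= N2; lra.
Qed.

End Counting.

(** * Affine coordinates *)

Lemma F3_cases (a : 'F_3) : [\/ a = 0, a = 1 | a = -1].
Proof.
by case: a => [[|[|[|//]]] ap]; [constructor 1|constructor 2|constructor 3];
  exact: val_inj.
Qed.

Lemma F3_third (a b : 'F_3) : a != b -> (- (a + b) != a) && (- (a + b) != b).
Proof. by case: (F3_cases a) => ->; case: (F3_cases b) => ->. Qed.

(** The points [(a, c)], [(b, d)] and [(- (a + b), - (c + d))] form a line of slope 1 off the
    diagonal. One of them has abscissa [m], and the implications make it the diagonal point
    [(m, m)]. *)
Lemma F3_line_meets_diagonal (a b c d m : 'F_3) :
  a != b -> a - c == b - d -> a != c ->
  (m == - (a + b)) ==> (m == - (c + d)) -> (m == b) ==> (m == d) ->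
  (m == a) ==> (m == c) -> False.
Proof.
by case: (F3_cases a) => ->; case: (F3_cases b) => -> //; case: (F3_cases c) => -> //;
  case: (F3_cases d) => -> //; case: (F3_cases m) => ->.
Qed.

Lemma F3_sum_or_diff (a b c d : 'F_3) :
  a != b -> c != d -> a - c != b - d -> a + c == b + d.
Proof.
by case: (F3_cases a) => ->; case: (F3_cases b) => -> //; case: (F3_cases c) => -> //;
  case: (F3_cases d) => ->.
Qed.

Lemma F3_sum_and_diff (a b c d : 'F_3) : a + c == b + d -> a - c == b - d -> a == b.
Proof.
by case: (F3_cases a) => ->; case: (F3_cases b) => -> //; case: (F3_cases c) => -> //;
  case: (F3_cases d) => ->.
Qed.

Section AffinePlane.

Variables (T : Type) (L : eqType) (f : 'I_4 -> T -> L).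

Hypothesis cover : forall i j k l, uniq [:: i; j; k; l] ->
  forall u v, [\/ f i u = f i v, f j u = f j v, f k u = f k v | f l u = f l v].

Hypothesis uncovered2 : forall i j a b, exists v, f i v <> a /\ f j v <> b.

Hypothesis meet : forall i j k l x y, uniq [:: i; j; k; l] ->
  exists v, f i v = f i x /\ f j v = f j y.

Ltac share U u v := case: (cover U u v) => ?; try congruence.

(** If colour [k] separates [u] from [v], a vertex outside their common classes of colours [i] and
    [j] must share [k] or [l] with each of them. This nearly fixes its labels, and vertices supplied
    by [meet] then violate [cover]. *)
Lemma agree_two i j k l u v : uniq [:: i; j; k; l] ->
  f i u = f i v -> f j u = f j v -> f k u = f k v.
Proof.
move=> U ui uj; case: (f k u =P f k v) => // nk; exfalso.
have Uil : uniq [:: i; l; j; k] by permute U.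
have Ujl : uniq [:: j; l; i; k] by permute U.
have Ukl : uniq [:: k; l; i; j] by permute U.
have Uik : uniq [:: i; k; j; l] by permute U.
have [a1 [a1u _]] := uncovered2 i i (f i u) (f i u).
have [a2 [a2u a21]] := uncovered2 i i (f i u) (f i a1).
have [b1 [b1u _]] := uncovered2 j j (f j u) (f j u).
have [b2 [b2u b21]] := uncovered2 j j (f j u) (f j b1).
case: (f l u =P f l v) => [ul|nl].
- have off w : f i w <> f i u -> f j w <> f j u -> f l w = f l u.
    by move=> wi wj; share U w u; share U w v.
  have [d1 [d1u _]] := uncovered2 l l (f l u) (f l u).
  have [d2 [d2u d21]] := uncovered2 l l (f l u) (f l d1).
  have [p [pi pl]] := meet a1 d1 Uil.
  have pj : f j p = f j u
    by apply: contrapT => n; have []: f l p <> f l u; [congruence|apply: off; congruence].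
  have [r [rj rl]] := meet b1 d2 Ujl.
  have ri : f i r = f i u
    by apply: contrapT => n; have []: f l r <> f l u; [congruence|apply: off; congruence].
  have pr : f k p = f k r by share U p r.
  have [p' [p'i p'l]] := meet a1 d2 Uil.
  have p'j : f j p' = f j u
    by apply: contrapT => n; have []: f l p' <> f l u; [congruence|apply: off; congruence].
  have [t [tp tp']] := uncovered2 k k (f k p) (f k p').
  (* The class of [t] in colour [k] avoids [p] and [p']. This forces [y] into the classes of [u] in
     colours [i] and [j]; then [w], outside both, shares colour [k] with [y] and nothing with
     [p]. *)
  have [y [yk yl]] := meet t d1 Ukl.
  have yi : f i y = f i u.
    case: (f i y =P f i u) => // ni.
    have yj : f j y = f j u
    by apply: contrapT => n; have []: f l y <> f l u; [congruence|apply: off; congruence].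
    by share U y r.
  have yj : f j y = f j u by case: (f j y =P f j u) => // n; share U y p'.
  have [w [wi wj]] := meet a2 b1 U.
  have wl : f l w = f l u by apply: off; congruence.
  have wk : f k w = f k y by share U w y.
  by share U w p.
have off w : f i w <> f i u -> f j w <> f j u ->
    f k w = f k u /\ f l w = f l v \/ f k w = f k v /\ f l w = f l u.
  by move=> wi wj; share U w u; share U w v; [left|right].
have [c3 [c3u c3v]] := uncovered2 k k (f k u) (f k v).
have [d3 [d3u d3v]] := uncovered2 l l (f l u) (f l v).
have [p [pi pk]] := meet a1 c3 Uik.
have pj : f j p = f j u by apply: contrapT => n; case: (off p) => [||[]|[]]; congruence.
have [q [qj ql]] := meet b1 d3 Ujl.
have qi : f i q = f i u by apply: contrapT => n; case: (off q) => [||[]|[]]; congruence.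
have [w [wi wj]] := meet a2 b1 U.
have [w' [w'i w'j]] := meet a1 b2 U.
have lp : f l p <> f l d3.
  case: (off w) => [||[wk wl]|[wk wl]]; try congruence; share U p w.
have kq : f k q <> f k c3.
  case: (off w') => [||[wk wl]|[wk wl]]; try congruence; share U q w'.
by share U p q.
Qed.

(** The class of [a] in colour [j] avoids [v0], so each of its vertices shares colour [i], [k] or
    [l] with [v0] and, by [agree_two], has the label of [p], [q] or [r] in colour [i]. Every class
    of colour [i] meets that class. *)
Lemma three_labels i j k l (v0 : T) : uniq [:: i; j; k; l] ->
  exists x : T -> 'F_3,
    (forall u v, f i u = f i v <-> x u = x v) /\ (forall t, exists u, x u = t).
Proof.
move=> U.
have Uji : uniq [:: j; i; k; l] by permute U.
have Ujk : uniq [:: j; k; i; l] by permute U.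
have Ujl : uniq [:: j; l; i; k] by permute U.
have Uikj : uniq [:: i; k; j; l] by permute U.
have Uilj : uniq [:: i; l; j; k] by permute U.
have Uklj : uniq [:: k; l; j; i] by permute U.
have Ujil : uniq [:: j; i; l; k] by permute U.
have [a [av _]] := uncovered2 j j (f j v0) (f j v0).
have [p [pj pi]] := meet a v0 Uji.
have [q [qj qk]] := meet a v0 Ujk.
have [r [rj rl]] := meet a v0 Ujl.
have npq : f i p <> f i q.
  move=> pq; have pqk := agree_two Uji (etrans pj (esym qj)) pq.
  have := agree_two Uikj pi (etrans pqk qk); congruence.
have npr : f i p <> f i r.
  move=> pr; have prl := agree_two Ujil (etrans pj (esym rj)) pr.
  have := agree_two Uilj pi (etrans prl rl); congruence.
have nqr : f i q <> f i r.
  move=> qr; have qrl := agree_two Ujil (etrans qj (esym rj)) qr.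
  have := agree_two Uklj qk (etrans qrl rl); congruence.
have three u : [\/ f i u = f i p, f i u = f i q | f i u = f i r].
  have [w [wi wj]] := meet u a U.
  case: (cover U w v0) => [e|e|e|e]; [constructor 1|exfalso|constructor 2|constructor 3];
    try congruence.
  - rewrite -wi; apply: (agree_two Ujk); congruence.
  - rewrite -wi; apply: (agree_two Ujl); congruence.
pose x u : 'F_3 := if f i u == f i p then 0 else if f i u == f i q then 1 else 2.
have xp u : f i u = f i p -> x u = 0 by move=> e; rewrite /x e eqxx.
have xq u : f i u = f i q -> x u = 1.
  by move=> e; rewrite /x e eqxx; case: eqP => // /esym.
have xr u : f i u = f i r -> x u = 2.
  by move=> e; rewrite /x e; case: eqP => [/esym//|_]; case: eqP => [/esym//|_].
exists x; split=> [u v|t].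
  split=> [e|]; first by rewrite /x e.
  case: (three u) => eu; case: (three v) => ev;
    by rewrite ?(xp _ eu) ?(xq _ eu) ?(xr _ eu) ?(xp _ ev) ?(xq _ ev) ?(xr _ ev) // eu ev.
case: t => [[|[|[|//]]] tp];
  [exists p; rewrite xp //|exists q; rewrite xq //|exists r; rewrite xr //];
  exact: val_inj.
Qed.

Lemma affine_coordinates i j k l (v0 : T) : uniq [:: i; j; k; l] ->
  exists x y : T -> 'F_3,
    (forall s t, exists u, x u = s /\ y u = t) /\
    [/\ forall u v, f i u = f i v <-> x u = x v,
        forall u v, f j u = f j v <-> y u = y v,
        forall u v, f k u = f k v <-> x u - y u = x v - y v
      & forall u v, f l u = f l v <-> x u + y u = x v + y v].
Proof.
move=> U.
have Ukj : uniq [:: k; j; i; l] by permute U.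
have Ujki : uniq [:: j; k; i; l] by permute U.
have Uik : uniq [:: i; k; j; l] by permute U.
have Uil : uniq [:: i; l; j; k] by permute U.
have Ujl : uniq [:: j; l; i; k] by permute U.
have Ukl : uniq [:: k; l; i; j] by permute U.
have Uijl : uniq [:: i; j; l; k] by permute U.
have [x [xP xsurj]] := three_labels v0 U.
have /choice[pt ptP] u : exists p, f k p = f k v0 /\ f j p = f j u := meet v0 u Ukj.
(* Labelling the classes of colour j through the k-class of v0 makes that class
   the line x = y. *)
pose y u := x (pt u).
have yP u v : f j u = f j v <-> y u = y v.
  have [uk uj] := ptP u; have [vk vj] := ptP v; rewrite /y -xP; split=> e.
    by apply: (agree_two Ujki); congruence.
  by rewrite -uj -vj; apply: (agree_two Uik); congruence.
have diag u : f k u = f k v0 <-> x u = y u.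
  have [uk uj] := ptP u; rewrite /y -xP; split=> e.
    by apply: (agree_two Ujki); congruence.
  by rewrite -uk; apply: (agree_two U); congruence.
have full s t : exists u, x u = s /\ y u = t.
  have [a xa] := xsurj s; have [b xb] := xsurj t.
  have [p [/xP pi /diag pk]] := meet b v0 Uik.
  have [u [/xP ui /yP uj]] := meet a p U.
  by exists u; rewrite ui uj xa -pk pi xb.
have diff u v : x u - y u = x v - y v -> f k u = f k v.
  move=> e; case: (x u =P x v) => [xuv|nx].
    apply: (agree_two U); first exact/xP.
    by apply/yP/oppr_inj/(addrI (x u)); rewrite e xuv.
  have ny : y u <> y v by move=> yuv; apply: nx; apply: (addIr (- y u)); rewrite e yuv.
  case: (x u =P y u) => [duv|nd].
    have dv : x v = y v by apply/eqP; rewrite -subr_eq0 -e duv subrr.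
    by rewrite (diag u).2 // (diag v).2.
  (* Otherwise [u], [v] and the third point [t] of their line lie in one class of colour [l]. It
     meets the diagonal in a vertex [q] that agrees with one of the three in colour [i], hence in
     [j] too, although their line is parallel to the diagonal. *)
  apply: contrapT => nk.
  have lu : f l u = f l v.
    by case: (cover U u v) => // [/xP|/yP].
  have [t [xt yt]] := full (- (x u + x v)) (- (y u + y v)).
  have [q [/diag qk ql]] := meet v0 u Ukl.
  have ij_ a b : x a = x b -> f l a = f l b -> y a = y b.
    by move=> /xP ? ?; apply/yP; apply: (agree_two Uil).
  have := ij_ q u; have := ij_ q v; have := ij_ q t.
  have tu := cover U t u; have tv := cover U t v.
  have lt : f l t = f l u.
    case: tu => [/xP|/yP| tk |//]; rewrite ?xt ?yt.
    - by move=> h; have /eqP/F3_third/andP[] := nx; rewrite h eqxx.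
    - by move=> h; have /eqP/F3_third/andP[] := ny; rewrite h eqxx.
    case: tv => [/xP|/yP| tk' | tl]; rewrite ?xt ?yt; try congruence.
    - by move=> h; have /eqP/F3_third/andP[] := nx; rewrite h eqxx.
    - by move=> h; have /eqP/F3_third/andP[] := ny; rewrite h eqxx.
  rewrite lt -lu ql -qk xt yt => ht hv hu.
  apply: (@F3_line_meets_diagonal (x u) (x v) (y u) (y v) (x q)); try exact/eqP.
  - by apply/implyP => /eqP/ht ->.
  - by apply/implyP => /eqP/hv ->.
  - by apply/implyP => /eqP/hu ->.
have kP u v : f k u = f k v <-> x u - y u = x v - y v.
  split=> [e|]; last exact: diff.
  have [w [xw yw]] := full (x v) (x v - (x u - y u)).
  have wk : f k w = f k u by apply: diff; rewrite xw yw subKr.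
  have /yP <- : f j w = f j v by apply: (agree_two Uik); [exact/xP|congruence].
  by rewrite yw subKr.
exists x, y; split=> //; split=> // u v; split=> [e|e].
  case: (x u =P x v) => [xuv|nx].
    have /yP -> : f j u = f j v by apply: (agree_two Uil) => //; exact/xP.
    by rewrite xuv.
  case: (y u =P y v) => [yuv|ny].
    by case: nx; apply/xP; apply: (agree_two Ujl) => //; exact/yP.
  have nd : x u - y u <> x v - y v.
    by move=> /kP ek; apply: nx; apply/xP; apply: (agree_two Ukl).
  by apply/eqP/F3_sum_or_diff; exact/eqP.
case: (x u =P x v) => [xuv|nx].
  apply: (agree_two Uijl); first exact/xP.
  by apply/yP/(addrI (x u)); rewrite e xuv.
case: (cover U u v) => // [/xP//|/yP yuv|/kP ek]; exfalso; apply: nx.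
  by apply: (addIr (y u)); rewrite e yuv.
by apply/eqP; apply: (@F3_sum_and_diff _ _ (y u) (y v)); exact/eqP.
Qed.

End AffinePlane.

(** * Colourings of the complete graph *)

Lemma bin2_double n : ('C(n, 2) * 2 = n * n.-1)%N.
Proof. by rewrite -[2%N in X in (_ * X)%N]/(2`!)%N bin_ffact ffactnS ffactn1. Qed.

(** The ratio of 'C(m, 2) to m^2 is (1 - 1/m)/2, which increases with m. This is the source of phi
    <= mu^2. *)
Lemma bin2_scale m n : (m <= n -> 'C(m, 2) * (n * n) <= (m * m) * 'C(n, 2))%N.
Proof.
have := bin2_double m; have := bin2_double n.
case: m => [|m]; case: n => [|n] //= hn hm le; try by lia.
move: ('C(m.+1, 2)) ('C(n.+1, 2)) hn hm => A B hn hm.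
have h : (m * n.+1 <= m.+1 * n)%N by nia.
have := leq_mul (leqnn (m.+1 * n.+1)) h.
have := congr1 (muln^~ (n.+1 * n.+1)%N) hm; have := congr1 (muln^~ (m.+1 * m.+1)%N) hn.
by move=> /=; nia.
Qed.

Section Coloring.

Variables (n : nat) (c : edge_coloring n 4).

Definition component_of (i : 'I_4) (v : 'I_n) : {set 'I_n} :=
  [set u | connect (color_adj c i) v u].

Lemma color_adj_sym i : symmetric (color_adj c i).
Proof. by move=> u v; apply: eq_existsb => e; rewrite setUC. Qed.

Lemma connect_color_sym i : connect_sym (color_adj c i).
Proof. exact: sym_connect_sym (@color_adj_sym i). Qed.

Lemma mem_component_of i u v :
  (u \in component_of i v) = (component_of i u == component_of i v).
Proof.
rewrite inE; apply/idP/eqP => [vu|/setP/(_ u)]; last by rewrite !inE connect0.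
by apply/setP => w; rewrite !inE (same_connect (@connect_color_sym i) vu).
Qed.

Lemma componentsE i : components c i = [set component_of i v | v : 'I_n].
Proof.
apply/setP => X; apply/imsetP/imsetP => -[v _ ->]; exists v => //;
  by apply/setP => u; rewrite !inE.
Qed.

Lemma component_of_in i v : component_of i v \in components c i.
Proof. by rewrite componentsE imset_f. Qed.

Lemma edge_component (e : edge n) u v :
  val e = [set u; v] -> component_of (c e) u = component_of (c e) v.
Proof.
move=> ee; apply/eqP; rewrite -mem_component_of inE connect_color_sym.
by apply: connect1; apply/existsP; exists e; rewrite ee !eqxx.
Qed.

Lemma component_of_cover u v : exists i, component_of i u = component_of i v.
Proof.
have [->|uv] := eqVneq u v; first by exists ord0.
have e2 : #|[set u; v]| == 2 by rewrite cards2 uv.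
by exists (c (Sub [set u; v] e2)); apply: edge_component; rewrite SubK.
Qed.

Lemma component_of_cover4 i j k l : uniq [:: i; j; k; l] -> forall u v,
  [\/ component_of i u = component_of i v, component_of j u = component_of j v,
      component_of k u = component_of k v | component_of l u = component_of l v].
Proof.
move=> U u v; have [x xuv] := component_of_cover u v.
have [_ /(_ x)] :
    (size [:: i; j; k; l] = size (enum 'I_4)) * ([:: i; j; k; l] =i enum 'I_4).
  apply: uniq_min_size => //; first by move=> y _; rewrite mem_enum.
  by rewrite size_enum_ord.
rewrite mem_enum !inE => /or4P[]/eqP xE; subst x;
  [constructor 1|constructor 2|constructor 3|constructor 4]; exact: xuv.
Qed.

Lemma card_component_edges i (X : {set 'I_n}) :
  (#|component_edges c i X| <= 'C(#|X|, 2))%N.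
Proof.
rewrite -cards_draws -(card_imset _ val_inj); apply: subset_leq_card.
apply/subsetP => _ /imsetP[e + ->]; rewrite !inE => /andP[_ ->] /=.
exact: (valP e).
Qed.

Lemma sum_component_edges :
  ('C(n, 2) <= \sum_i \sum_(X in components c i) #|component_edges c i X|)%N.
Proof.
rewrite -card_edge -sum1_card (partition_big c xpredT) //=.
apply: leq_sum => i _; rewrite sum1_card.
have card_cover (Q : {set {set 'I_n}}) :
  (#|\bigcup_(X in Q) component_edges c i X| <= \sum_(X in Q) #|component_edges c i X|)%N.
  elim/big_ind2: _ => [|A a B b la lb|//]; first by rewrite cards0.
  by apply: leq_trans (leq_card_setU _ _) (leq_add la lb).
apply: leq_trans (card_cover _); apply: subset_leq_card.
apply/subsetP => e ie; have /eqP ce : c e == i := ie.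
have /cards2P[u [v [uv ee]]] := valP e.
apply/bigcupP; exists (component_of i u); first exact: component_of_in.
rewrite inE ce eqxx /= ee; apply/subsetP => w; rewrite in_set2 mem_component_of.
by case/orP => /eqP ->; rewrite // -ce (edge_component ee).
Qed.

End Coloring.

(** * The four parallel classes in coordinates *)

Definition linear_form (i : 'I_4) (p : point) : 'F_3 :=
  [:: p 0 0; p 0 1; p 0 0 - p 0 1; p 0 0 + p 0 1]`_i.

(** Spans the kernel of [linear_form i]. *)
Definition direction (i : 'I_4) : point :=
  \row_(m < 2) (if m == 0 then [:: 0; 1; 1; 1]`_i else [:: 1; 0; 1; -1]`_i).

Lemma point_eq (p q : point) : p 0 0 = q 0 0 -> p 0 1 = q 0 1 -> p = q.
Proof.
move=> e0 e1; apply/rowP => -[[|[|//]] m2].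
- by rewrite (_ : Ordinal m2 = 0) //; exact: val_inj.
- by rewrite (_ : Ordinal m2 = 1) //; exact: val_inj.
Qed.

Lemma mem_line i a p :
  (p \in line a (direction i)) = (linear_form i p == linear_form i a).
Proof.
apply/imsetP/eqP => [[t _ ->]|].
  by case: i => [[|[|[|[|//]]]] i4]; rewrite /linear_form /= !mxE /=; ring.
case: i => [[|[|[|[|//]]]] i4]; rewrite /linear_form /= => e.
- by exists (p 0 1 - a 0 1) => //; apply: point_eq; rewrite !mxE /= ?e; ring.
- by exists (p 0 0 - a 0 0) => //; apply: point_eq; rewrite !mxE /= ?e; ring.
- exists (p 0 0 - a 0 0) => //; apply: point_eq; rewrite !mxE /=; first by ring.
  by rewrite -[LHS](subKr (p 0 0)) e; ring.
- exists (p 0 0 - a 0 0) => //; apply: point_eq; rewrite !mxE /=; first by ring.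
  by rewrite -[LHS](addKr (p 0 0)) e; ring.
Qed.

Lemma mem_line_self (a v : point) : a \in line a v.
Proof. by apply/imsetP; exists 0; rewrite // scale0r addr0. Qed.

Lemma direction_neq0 i : direction i != 0.
Proof.
apply/eqP => /rowP d0; move: (d0 0) (d0 1); rewrite !mxE /=.
by case: i {d0} => [[|[|[|[|//]]]] i4].
Qed.

Lemma direction_inj_class : injective (fun i => parallel_class (direction i)).
Proof.
move=> i j /= ij.
have /imsetP[b _ bE] : line 0 (direction i) \in parallel_class (direction j).
  by rewrite -ij; apply/imsetP; exists 0.
have b0 : linear_form j b = linear_form j 0.
  by apply/esym/eqP; rewrite -mem_line -bE mem_line_self.
have : direction i \in line b (direction j).
  by rewrite -bE; apply/imsetP; exists 1; rewrite // add0r scale1r.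
rewrite mem_line b0; case: i {ij bE} => [[|[|[|[|//]]]] i4];
  case: j b0 => [[|[|[|[|//]]]] j4] _; rewrite /linear_form /= !mxE //= => _;
  exact: val_inj.
Qed.

Lemma lineN (a v : point) : line a (- v) = line a v.
Proof.
apply/setP => p; apply/imsetP/imsetP => -[t _ ->]; exists (- t) => //.
  by rewrite scalerN scaleNr.
by rewrite scaleNr scalerN opprK.
Qed.

Lemma direction_exhaust (v : point) : v != 0 ->
  exists i, v = direction i \/ v = - direction i.
Proof.
move=> v0.
have ex (m : nat) : (m < 4)%N ->
    v 0 0 = [:: 0; 1; 1; 1]`_m /\ v 0 1 = [:: 1; 0; 1; -1]`_m \/
    v 0 0 = - [:: 0; 1; 1; 1]`_m /\ v 0 1 = - [:: 1; 0; 1; -1]`_m ->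
    exists i, v = direction i \/ v = - direction i.
  move=> m4 h; exists (Ordinal m4).
  by case: h => -[ea eb]; [left|right]; apply: point_eq; rewrite !mxE /= ?ea ?eb.
case: (F3_cases (v 0 0)) => va; case: (F3_cases (v 0 1)) => vb.
- by case/eqP: v0; apply: point_eq; rewrite !mxE ?va ?vb.
- by apply: (ex 0%N) => //; left; rewrite va vb.
- by apply: (ex 0%N) => //; right; rewrite va vb oppr0.
- by apply: (ex 1%N) => //; left; rewrite va vb.
- by apply: (ex 2%N) => //; left; rewrite va vb.
- by apply: (ex 3%N) => //; left; rewrite va vb.
- by apply: (ex 1%N) => //; right; rewrite va vb oppr0.
- by apply: (ex 3%N) => //; right; rewrite va vb opprK.
- by apply: (ex 2%N) => //; right; rewrite va vb.
Qed.

Lemma direction_classes :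
  [set parallel_class (direction i) | i : 'I_4] = parallel_classes.
Proof.
apply/setP => C; apply/imsetP/imsetP => [[i _ ->]|[v]].
  by exists (direction i); rewrite ?inE ?direction_neq0.
rewrite inE => /direction_exhaust[i [|] -> ->]; exists i => //.
by apply: eq_imset => a; exact: lineN.
Qed.

Lemma affine_matches n (c : edge_coloring n 4) (x y : 'I_n -> 'F_3) :
  (forall s t, exists u, x u = s /\ y u = t) ->
  (forall i u v, component_of c i u = component_of c i v <->
     [:: x u; y u; x u - y u; x u + y u]`_i = [:: x v; y v; x v - y v; x v + y v]`_i) ->
  matches_gyarfas c.
Proof.
move=> full fE.
pose co u : point := \row_(m < 2) (if m == 0 then x u else y u).
have coE i u : linear_form i (co u) = [:: x u; y u; x u - y u; x u + y u]`_i.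
  by rewrite /linear_form !mxE.
have co_full p : exists u, co u = p.
  have [u [xu yu]] := full (p 0 0) (p 0 1); exists u.
  by apply: point_eq; rewrite !mxE.
have memE i u v :
    (u \in component_of c i v) = (linear_form i (co u) == linear_form i (co v)).
  rewrite mem_component_of; apply/eqP/eqP; first by move=> /fE; rewrite !coE.
  by rewrite !coE => /fE.
have surj i t : exists u, linear_form i (co u) = t.
  have [p pt] : exists p : point, linear_form i p = t.
    case: i => [[|[|[|[|//]]]] i4]; rewrite /linear_form /=.
    - by exists (const_mx t); rewrite mxE.
    - by exists (const_mx t); rewrite mxE.
    - by exists (\row_m (if m == 0 then t else 0)); rewrite !mxE subr0.
    - by exists (\row_m (if m == 0 then t else 0)); rewrite !mxE addr0.
  by have [u up] := co_full p; exists u; rewrite up.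
have compE i : components c i = [set [set u | linear_form i (co u) == t] | t : 'F_3].
  rewrite componentsE; apply/setP => X; apply/imsetP/imsetP => -[z _ ->].
    by exists (linear_form i (co z)) => //; apply/setP => u; rewrite memE inE.
  have [v vz] := surj i z; exists v => //; apply/setP => u.
  by rewrite memE inE vz.
split=> [i|].
  rewrite compE card_imset ?card_Fp // => s t /setP st.
  have [u us] := surj i s.
  by have := st u; rewrite !inE us eqxx => /esym/eqP.
exists (fun p => [set u | co u == p]), (fun i => parallel_class (direction i)); split.
- move=> p; have [u <-] := co_full p.
  by apply/set0Pn; exists u; rewrite inE.
- move=> p q pq; rewrite -setI_eq0; apply/eqP/setP => u; rewrite !inE.
  by apply/negP => /andP[/eqP -> /eqP e]; rewrite e eqxx in pq.
- apply/setP => u; rewrite inE; apply/bigcupP; exists (co u) => //; by rewrite inE.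
- by split; [exact: direction_inj_class|exact: direction_classes].
move=> i; have lineE a : \bigcup_(p in line a (direction i)) [set u | co u == p] =
    [set u | linear_form i (co u) == linear_form i a].
  apply/setP => u; rewrite inE -mem_line; apply/bigcupP/idP => [[p pl]|ul].
    by rewrite inE => /eqP ->.
  by exists (co u); rewrite // inE.
rewrite compE; apply/setP => X; apply/imsetP/imsetP => -[z].
  move=> _ ->; have [v <-] := surj i z.
  exists (line (co v) (direction i)); last by rewrite lineE.
  by apply/imsetP; exists (co v).
by move=> /imsetP[a _ ->] ->; exists (linear_form i a); rewrite // lineE.
Qed.

(** * Colourings whose components are all small *)

Section Bound.

Variables (R : realType) (n : nat) (c : edge_coloring n 4) (N : R).
Hypotheses (n_gt0 : (0 < n)%N) (N_gt3 : 3 < N) (N_lt : N < 7 / 2).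
Hypothesis N2 : N * N = 5 + 2 * N.
Hypothesis small : forall i X, X \in components c i ->
  N * N * #|component_edges c i X|%:R < ('C(n, 2))%:R.

(** The bound [small] is strict with a nonnegative left side, so a single component shows that there
    are edges. *)
Let bin_gt0 : 0 < ('C(n, 2))%:R :> R.
Proof.
apply: le_lt_trans (small (component_of_in c ord0 (Ordinal n_gt0))).
by rewrite mulr_ge0 // mulr_ge0 //; move: N_gt3; lra.
Qed.

Let w : R := N / n%:R.

(** The value 0 off the components makes the bounds on [phi] hold for every set. *)
Let phi (i : 'I_4) (X : {set 'I_n}) : R :=
  if X \in components c i
  then N * N * #|component_edges c i X|%:R / ('C(n, 2))%:R else 0.

Let s i := \sum_(X in [set component_of c i v | v : 'I_n]) phi i X.

Let w_ge0 : 0 <= w.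
Proof. by rewrite divr_ge0 //; move: N_gt3; lra. Qed.

Let NE : w * #|'I_n|%:R = N.
Proof. by rewrite card_ord divfK // pnatr_eq0 -lt0n. Qed.

Let phi_lt1 i X : phi i X < 1.
Proof. by rewrite /phi; case: ifP => // /small; rewrite ltr_pdivrMr // mul1r. Qed.

Let phi_sq i X : phi i X <= (w * #|X|%:R) ^+ 2.
Proof.
rewrite /phi; case: ifP => _; last exact: sqr_ge0.
have n0 : 0 < n%:R :> R by rewrite ltr0n.
have le_e : (#|component_edges c i X| * (n * n) <= #|X| * #|X| * 'C(n, 2))%N.
  apply: leq_trans (bin2_scale _); first by rewrite leq_mul2r card_component_edges orbT.
  by rewrite -[n in (_ <= n)%N]card_ord max_card.
rewrite ler_pdivrMr //.
have -> : (w * #|X|%:R) ^+ 2 * ('C(n, 2))%:R =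
    N * N * (#|X|%:R * #|X|%:R * ('C(n, 2))%:R) / (n%:R * n%:R).
  by rewrite /w; field; rewrite lt0r_neq0.
rewrite ler_pdivlMr ?mulr_gt0 // -[leLHS]mulrA; apply: ler_wpM2l.
  by rewrite mulr_ge0 //; move: N_gt3; lra.
by move: le_e; rewrite -(ler_nat R) !natrM.
Qed.

Let total : N * N <= \sum_i s i.
Proof.
have -> : \sum_i s i = N * N *
    (\sum_i \sum_(X in components c i) #|component_edges c i X|)%N%:R / ('C(n, 2))%:R.
  rewrite natr_sum mulr_sumr mulr_suml; apply: eq_bigr => i _.
  rewrite /s -componentsE natr_sum mulr_sumr mulr_suml.
  by apply: eq_bigr => X Xi; rewrite /phi Xi.
rewrite ler_pdivlMr // ler_wpM2l ?ler_nat ?sum_component_edges //.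
by rewrite mulr_ge0 //; move: N_gt3; lra.
Qed.

Lemma small_components_match : matches_gyarfas c.
Proof.
have sE i : s i = \sum_(X in [set component_of c i v | v : 'I_n]) phi i X by [].
have uncov := two_classes_do_not_cover (mem_component_of c) NE w_ge0 phi_lt1 phi_sq
  N2 N_gt3 N_lt sE total.
have des := design_impossible (mem_component_of c) NE w_ge0 phi_lt1 phi_sq
  N2 N_gt3 sE total.
have cov := component_of_cover4 c.
have meet i j k l x y := @classes_meet _ _ _ cov uncov des i j k l x y.
pose o0 := @Ordinal 4 0 isT; pose o1 := @Ordinal 4 1 isT.
pose o2 := @Ordinal 4 2 isT; pose o3 := @Ordinal 4 3 isT.
have U : uniq [:: o0; o1; o2; o3] by [].
have [x [y [full [f0 f1 f2 f3]]]] :=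
  affine_coordinates cov uncov meet (Ordinal n_gt0) U.
apply: (affine_matches full) => i u v.
case: i => [[|[|[|[|//]]]] i4] /=; rewrite (bool_irrelevance i4 isT).
- exact: f0.
- exact: f1.
- exact: f2.
- exact: f3.
Qed.

End Bound.

(** * The constant and the final bounds *)

(** The bound 2.45 is sharp enough: it gives N^2 < 11.9, and 1/11.9 - 1/12 = 1/1428 > 7/10000. *)
Lemma sqrt6_bounds (R : realType) : 2 < Num.sqrt 6 :> R /\ Num.sqrt 6 < 245 / 100 :> R.
Proof.
have h : Num.sqrt 6 * Num.sqrt 6 = 6 :> R by rewrite -expr2 sqr_sqrtr.
by have := sqrtr_ge0 (6 : R); split; nra.
Qed.

Lemma gyarfas_constant (R : realType) : let N : R := 1 + Num.sqrt 6 in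
  2 / (14 + Num.sqrt 96) = (N * N)^-1 /\ N * N = 5 + 2 * N.
Proof.
have h : Num.sqrt 6 * Num.sqrt 6 = 6 :> R by rewrite -expr2 sqr_sqrtr.
have h96 : Num.sqrt 96 = 4 * Num.sqrt 6 :> R.
  rewrite (_ : 96 = 4 ^+ 2 * 6); last by rewrite expr2; ring.
  by rewrite sqrtrM ?sqr_ge0 // sqrtr_sqr ger0_norm.
have [s2 _] := sqrt6_bounds R.
move=> N; rewrite /N h96; split; last by nra.
have -> : (1 + Num.sqrt 6) * (1 + Num.sqrt 6) = (14 + 4 * Num.sqrt 6) / 2 :> R by nra.
by rewrite invf_div.
Qed.

(** Twelve components share all the edges, so one reaches the average. This handles the colourings
    that match the construction. *)
Lemma three_components_each_large (R : realType) (n : nat) (c : edge_coloring n 4) :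
  (0 < n)%N -> (forall i, #|components c i| = 3) ->
  exists (i : 'I_4) (A : {set 'I_n}), A \in components c i /\
    1 / 12 * ('C(n, 2))%:R <= (#|component_edges c i A|)%:R :> R.
Proof.
move=> n_gt0 c3; apply: contrapT => none.
have small i X : X \in components c i ->
    (#|component_edges c i X|)%:R < 1 / 12 * ('C(n, 2))%:R :> R.
  by move=> Xi; rewrite ltNge; apply/negP => h; apply: none; exists i, X.
have := sum_component_edges c; rewrite -(ler_nat R) natr_sum; apply/negP; rewrite -ltNge.
apply: lt_le_trans (_ : \sum_(i < 4) (3 * (1 / 12 * ('C(n, 2))%:R)) <= _); last first.
  by rewrite sumr_const card_ord -mulr_natr; lra.
have lt3 i : ((\sum_(X in components c i) #|component_edges c i X|)%N)%:R
    < 3 * (1 / 12 * ('C(n, 2))%:R) :> R.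
  rewrite natr_sum.
  have -> : 3 * (1 / 12 * ('C(n, 2))%:R)
      = \sum_(X in components c i) (1 / 12 * ('C(n, 2))%:R) :> R.
    by rewrite sumr_const c3 -[RHS]mulr_natl.
  have Xi := component_of_in c i (Ordinal n_gt0).
  rewrite (bigD1 _ Xi) /= [ltRHS](bigD1 _ Xi) /=; apply: ltr_leD; first exact: small.
  by apply: ler_sum => X /andP[/small/ltW].
rewrite (bigD1 ord0) //= [ltRHS](bigD1 ord0) //=; apply: ltr_leD => //.
by apply: ler_sum => i _; exact: ltW.
Qed.

Theorem theorem1p2 (R : realType) (n : nat) (n_gt0 : (0 < n)%N) :
  let eps : R := 2 / (14 + Num.sqrt 96) - 1 / 12 in
  [/\ forall c : edge_coloring n 4,
        exists (i : 'I_4) (A : {set 'I_n}),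
          A \in components c i /\
          1 / 12 * ('C(n, 2))%:R <= (#|component_edges c i A|)%:R :> R,
      Num.ceil (1 / 12 * ('C(n, 2))%:R : R) <= (M n 4)%:Z,
      forall c : edge_coloring n 4, ~ matches_gyarfas c ->
        exists (i : 'I_4) (A : {set 'I_n}),
          A \in components c i /\
          (1 / 12 + eps) * ('C(n, 2))%:R <= (#|component_edges c i A|)%:R :> R
    & 7 / 10000 < eps].
Proof.
move=> eps.
have [s2 s245] := sqrt6_bounds R; have [cE N2] := gyarfas_constant R.
set N : R := 1 + Num.sqrt 6 in cE N2.
have N_gt3 : 3 < N by rewrite /N; lra.
have N_lt : N < 345 / 100 by rewrite /N; lra.
have NN0 : 0 < N * N by rewrite N2; lra.
have epsE : 1 / 12 + eps = (N * N)^-1 by rewrite -cE /eps addrC subrK.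
have eps_gt : 7 / 10000 < eps.
  have : (119 / 10)^-1 <= (N * N)^-1 by rewrite lef_pV2 ?posrE //; [rewrite N2; lra|lra].
  by rewrite -epsE invf_div; lra.
have unmatched (c : edge_coloring n 4) : ~ matches_gyarfas c ->
    exists (i : 'I_4) (A : {set 'I_n}), A \in components c i /\
      (1 / 12 + eps) * ('C(n, 2))%:R <= (#|component_edges c i A|)%:R :> R.
  move=> nm; apply: contrapT => none; apply: nm.
  apply: (@small_components_match R n c N) => //; first lra.
  move=> i X Xi; rewrite ltNge; apply/negP => h; apply: none; exists i, X; split=> //.
  by rewrite epsE mulrC ler_pdivrMr // mulrC.
have large (c : edge_coloring n 4) : exists (i : 'I_4) (A : {set 'I_n}),
    A \in components c i /\
    1 / 12 * ('C(n, 2))%:R <= (#|component_edges c i A|)%:R :> R.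
  (* Counting components is enough: a colouring in which some colour does not have three cannot
     match, so the stronger bound applies to it. *)
  have [/forallP c3|/forallPn[i ci]] := boolP [forall i, #|components c i| == 3].
    by apply: three_components_each_large => // i; exact/eqP.
  have [|j [A [Aj le_e]]] := unmatched c.
    by move=> [c3 _]; rewrite c3 eqxx in ci.
  exists j, A; split=> //; apply: le_trans le_e.
  by rewrite ler_wpM2r // lerDl; lra.
split=> //.
set x : R := 1 / 12 * _.
have x0 : 0 <= x by rewrite /x mulr_ge0 //; lra.
have cx0 : 0 <= Num.ceil x by rewrite (le_trans _ (le_ceil x0)) // ceil0.
rewrite -[Num.ceil x]gez0_abs // lez_nat leq_M //.
apply/forallP => c; have [i [A [Ai le_e]]] := large c.
apply/existsP; exists i; apply/existsP; exists A; rewrite Ai /=.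
by rewrite -lez_nat gez0_abs // ceil_le_int.
Qed.
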